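(* Let $n\ge 3$ and $2\le k\le n-1$, and let $M^n$ be a complete $f$-minimal hypersurface properly immersed in the cylinder shrinking Ricci soliton $\mathbb{R}^{n+1-k}\times S^k_{\sqrt{2(k-1)}}(0)$. Then $$\inf_{M^n} H<\frac{\sqrt{2(n+1-k)}}{2}.$$
   Context: The cylinder shrinking Ricci soliton is $\bar M^{n+1}=\mathbb{R}^{n+1-k}\times S^k_{\sqrt{2(k-1)}}(0)$ with the product metric and potential function $f(x,y)=|x|^2/4$, where $x$ is the position vector in $\mathbb{R}^{n+1-k}$, $y$ the position vector in $\mathbb{R}^{k+1}$, and $S^k_\rho(0)\subset\mathbb{R}^{k+1}$ is the round sphere of radius $\rho$ centered at $0$. $M^n$ is an oriented immersed hypersurface with unit normal $N$; $\bar\nabla$ is the Levi-Civita connection of $\bar M$; $A(u,v)=\langle\bar\nabla_uv,N\rangle$, $\vec H=(\mathrm{tr}_{M^n}A)N=-HN$ ($H$ the scalar mean curvature), $\vec H_f=\vec H+(\bar\nabla f)^\perp=-H_fN$ ($H_f$ the weighted mean curvature), so $H_f=H-\langle\bar\nabla f,N\rangle$. $M^n$ is $f$-minimal if $H_f=0$. *)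

(* Defs.v *)
From HB Require Import structures.
From mathcomp Require Import all_boot all_order all_algebra.
From mathcomp Require Import all_classical all_reals all_analysis.

Set Implicit Arguments.
Unset Strict Implicit.
Unset Printing Implicit Defensive.

Import Order.TTheory GRing.Theory Num.Theory.
Import numFieldNormedType.Exports.

Local Open Scope classical_set_scope.
Local Open Scope ring_scope.

(* For V and W finite-dimensional and U open, quantifying over all directions v
   rather than over a basis of V yields the same class of functions. *)
Fixpoint Ck (R : realType) (V W : normedModType R) (m : nat) (U : set V)
    (F : V -> W) : Prop :=
  (forall x, U x -> {for x, continuous F}) /\
  match m with
  | 0 => True
  | m'.+1 => forall v : V,
      (forall x, U x -> derivable F x v) /\ Ck m' U (fun x => 'D_v F x)
  end.

Definition smooth_on (R : realType) (V W : normedModType R) (U : set V)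
  (F : V -> W) : Prop := forall m, Ck m U F.

(* chart_inv matters only on the image of chart_dom. *)
Record chart (R : realType) (n : nat) (M : topologicalType) := Chart {
  chart_dom : set M;
  chart_map : M -> 'rV[R]_n;
  chart_inv : 'rV[R]_n -> M;
  chart_dom_open : open chart_dom;
  chart_img_open : open (chart_map @` chart_dom);
  chart_mapK : forall p, chart_dom p -> chart_inv (chart_map p) = p;
  chart_map_cont : forall p, chart_dom p -> {for p, continuous chart_map};
  chart_inv_cont : forall u, (chart_map @` chart_dom) u ->
    {for u, continuous chart_inv}
}.

Definition chart_img (R : realType) (n : nat) (M : topologicalType)
  (c : chart R n M) : set 'rV[R]_n := chart_map c @` chart_dom c.

Definition compatible (R : realType) (n : nat) (M : topologicalType)
  (c d : chart R n M) : Prop :=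
  smooth_on (chart_map c @` (chart_dom c `&` chart_dom d))
            (chart_map d \o chart_inv c).

(* Smooth n-manifolds without boundary, not assumed connected or nonempty.
   The atlas need not be maximal. *)
Record smooth_manifold (R : realType) (n : nat) := SmoothManifold {
  carrier :> topologicalType;
  mfd_hausdorff : hausdorff_space carrier;
  mfd_second_countable : @second_countable carrier;
  atlas : set (chart R n carrier);
  chart_at : carrier -> chart R n carrier;
  chart_at_atlas : forall p, atlas (chart_at p);
  chart_at_dom : forall p, chart_dom (chart_at p) p;
  atlas_compatible : forall c d, atlas c -> atlas d -> compatible c d
}.

Definition smooth_map (R : realType) (n : nat) (M : smooth_manifold R n)
  (W : normedModType R) (F : M -> W) : Prop :=
  forall c, atlas c -> smooth_on (chart_img c) (F \o chart_inv c).

Definition dot (R : realType) (m : nat) (u v : 'rV[R]_m) : R :=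
  \sum_(i < m) u 0 i * v 0 i.

(* R^a x R^b, which contains the cylinder R^a x S^(b-1)_rho.  The library norm
   on it is a sup norm, used only for the topology; metric notions go through
   edot and enorm. *)
Notation euc R a b := ('rV[R]_a * 'rV[R]_b)%type.

Definition edot (R : realType) (a b : nat) (z w : euc R a b) : R :=
  dot z.1 w.1 + dot z.2 w.2.

Definition enorm (R : realType) (a b : nat) (z : euc R a b) : R :=
  Num.sqrt (edot z z).

Definition cylinder (R : realType) (a b : nat) (rho : R) : set (euc R a b) :=
  [set z | Num.sqrt (dot z.2 z.2) = rho].

(* R^(n+1-k) x S^k with radius sqrt(2(k-1)). *)
Definition cylinder_soliton (R : realType) (n k : nat)
  : set (euc R (n.+1 - k) k.+1) :=
  cylinder (Num.sqrt (2 * (k - 1)%:R)).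
Arguments cylinder_soliton : clear implicits.

Definition potential (R : realType) (a b : nat) (z : euc R a b) : R :=
  dot z.1 z.1 / 4.

Definition cyl_tangent (R : realType) (a b : nat) (z w : euc R a b) : Prop :=
  dot w.2 z.2 = 0.

(* Orthogonal projection of w onto the tangent space at z of the cylinder
   through z. *)
Definition cyl_proj (R : realType) (a b : nat) (z w : euc R a b) : euc R a b :=
  (w.1, w.2 - (dot w.2 z.2 / dot z.2 z.2) *: z.2).

Definition euc_grad (R : realType) (a b : nat) (F : euc R a b -> R)
  (z : euc R a b) : euc R a b :=
  (\row_i 'D_((delta_mx 0 i, 0) : euc R a b) F z,
   \row_j 'D_((0, delta_mx 0 j) : euc R a b) F z).

(* Gradient, in the induced metric of the cylinder, of the restriction of F. *)
Definition cyl_grad (R : realType) (a b : nat) (F : euc R a b -> R)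
  (z : euc R a b) : euc R a b :=
  cyl_proj z (euc_grad F z).

Definition basis_vec (R : realType) (n : nat) (i : 'I_n) : 'rV[R]_n :=
  delta_mx 0 i.

Section Hypersurface.
Variables (R : realType) (n a b : nat) (M : smooth_manifold R n).
Implicit Types (X N : M -> euc R a b) (c : chart R n M) (p : M).

Definition immersion X : Prop :=
  smooth_map X /\
  forall c, atlas c -> forall u, chart_img c u ->
    forall v, 'D_v (X \o chart_inv c) u = 0 -> v = 0.

(* Properness of X as a map into the subspace S. *)
Definition proper_into (S : set (euc R a b)) X : Prop :=
  forall K : set (euc R a b), K `<=` S -> compact K -> compact (X @^-1` K).

Definition unit_normal X N : Prop :=
  [/\ smooth_map N,
      forall p, cyl_tangent (X p) (N p),
      forall p, edot (N p) (N p) = 1 &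
      forall c, atlas c -> forall u, chart_img c u ->
        forall v, edot ('D_v (X \o chart_inv c) u) (N (chart_inv c u)) = 0].

Definition C1_curve (gamma : R -> M) : Prop :=
  continuous gamma /\
  forall c, atlas c ->
    Ck 1 (gamma @^-1` chart_dom c) (chart_map c \o gamma).

(* The speed of gamma in the metric induced by X is the Euclidean norm of
   (X o gamma)'. *)
Definition curve_length X (gamma : R -> M) : \bar R :=
  \int[lebesgue_measure]_(t in `[0, 1])
    (enorm ('D_1 (X \o gamma) t))%:E.

(* Curves are C^1 on all of R and need not be regular, so that reparametrized
   piecewise C^1 paths are covered; points of different components are at
   distance +oo. *)
Definition riem_dist X (p q : M) : \bar R :=
  ereal_inf [set curve_length X gamma | gamma in
    [set gamma | [/\ C1_curve gamma, gamma 0 = p & gamma 1 = q]]].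

Definition riem_complete X : Prop :=
  forall s : nat -> M,
    (forall e : R, 0 < e -> exists j0 : nat, forall i j : nat,
       (j0 <= i)%N -> (j0 <= j)%N -> (riem_dist X (s i) (s j) < e%:E)%E) ->
    exists p : M, riem_dist X (s i) p @[i --> \oo] --> 0%E.

Definition metric_mx X c p : 'M[R]_n :=
  \matrix_(i, j)
    edot ('D_(basis_vec R i) (X \o chart_inv c) (chart_map c p))
         ('D_(basis_vec R j) (X \o chart_inv c) (chart_map c p)).

(* Covariant derivative in the cylinder of the j-th coordinate field along the
   i-th one: the tangential part of the second partial derivative of X. *)
Definition cov_deriv X c p (i j : 'I_n) : euc R a b :=
  cyl_proj (X p)
    ('D_(basis_vec R i)
       (fun u => 'D_(basis_vec R j) (X \o chart_inv c) u) (chart_map c p)).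

Definition second_form_mx X N c p : 'M[R]_n :=
  \matrix_(i, j) edot (cov_deriv X c p i j) (N p).

(* Sign convention: the mean curvature vector (tr A) N equals - H N, so H is
   positive on a round sphere with outward normal.  The trace does not depend
   on the chart around p. *)
Definition mean_curvature X N p : R :=
  - \tr (invmx (metric_mx X (chart_at p) p) *m
         second_form_mx X N (chart_at p) p).

Definition weighted_mean_curvature (f : euc R a b -> R) X N p : R :=
  mean_curvature X N p - edot (cyl_grad f (X p)) (N p).

Definition f_minimal (f : euc R a b -> R) X N : Prop :=
  forall p, weighted_mean_curvature f X N p = 0.

End Hypersurface.

(* Main.v *)
Require Import Defs.
From HB Require Import structures.
From mathcomp Require Import all_boot all_order all_algebra.
From mathcomp Require Import all_classical all_reals all_analysis.
From mathcomp Require Import ring lra zify.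

Import Order.TTheory GRing.Theory Num.Theory.
Import numFieldNormedType.Exports.

Local Open Scope classical_set_scope.
Local Open Scope ring_scope.

(** The bound is obtained by looking at a point of the hypersurface closest to
    the axis of the cylinder.  Write a = n + 1 - k for the dimension of the flat
    factor, x for the flat part of the position X, and N1 for the flat part of
    the normal.  Since the other factor is a compact sphere and X is proper, the
    sublevel sets of |x|^2 on M are compact, so |x|^2 attains its minimum at
    some p (proper_attains_min).

    At p the vector (x, 0) is tangent to the cylinder and, the gradient of
    |x|^2 vanishing, normal to M; hence (x, 0) = lam N with lam = <x, N1>.
    f-minimality says that lam = 2 H.  The Laplacian of |x|^2 on M is twice
      tr (P Q) + lam tr A,  with tr A = - H,
    where P is the projection on the flat factor and Q the projection on T_p M.
    As Q, the normal N and the unit radial vector of the sphere resolve the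
    identity of the ambient space (frame_resolution), and the radial vector has
    no flat component, tr (P Q) = a - |N1|^2.  The Laplacian is nonnegative at a
    minimum, which gives 2 H^2 + |N1|^2 <= a at p
    (min_trace_bound, mean_curvature_bound_at_min).

    If inf H were at least sqrt (2 a) / 2, then 2 H^2 >= a at p, which forces
    N1 = 0; but then H = <x, N1> / 2 = 0 at p, a contradiction because a > 0.

    The Laplacian is handled as the trace of the Hessian in a chart against the
    inverse metric.  Smoothness is phrased by directional derivatives, so the
    linearity of D_v in v and the bilinearity of the second derivative
    are first deduced from the mean value theorem (derive_sum_dir,
    derive2_sum_dir), for real functions, and then used on the coordinates of
    X. *)

Set Implicit Arguments.
Unset Strict Implicit.
Unset Printing Implicit Defensive.

(** * Directional derivatives and smoothness *)

Section Calculus.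
Variables (R : realType) (V : normedModType R).

Lemma is_derive_line (W : normedModType R) (f : V -> W) (a v : V) (t : R) :
  derivable f (t *: v + a) v ->
  is_derive t 1 (fun s : R => f (s *: v + a)) ('D_v f (t *: v + a)).
Proof.
move=> df.
have E : (fun h : R => h^-1 *: (((fun s : R => f (s *: v + a)) \o shift t) (h *: 1)
                       - f (t *: v + a)))
       = (fun h : R => h^-1 *: ((f \o shift (t *: v + a)) (h *: v)
                       - f (t *: v + a))).
  by apply/funext => h /=; rewrite scaler1 scalerDl addrA.
by split; rewrite /derivable /derive E.
Qed.

Lemma is_derive_comp_linear (W W' : normedModType R) (L : {linear W -> W'})
    (f : V -> W) (x v : V) :
  continuous L -> derivable f x v ->
  is_derive x v (L \o f) (L ('D_v f x)).
Proof.
move=> Lc df.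
have E : (fun h : R => h^-1 *: (((L \o f) \o shift x) (h *: v) - (L \o f) x))
       = L \o (fun h : R => h^-1 *: ((f \o shift x) (h *: v) - f x)).
  by apply/funext => h /=; rewrite [RHS]linearZZ [L (_ - _)]linearB.
have C : (fun h : R => h^-1 *: (((L \o f) \o shift x) (h *: v) - (L \o f) x))
     @ 0^' --> L ('D_v f x).
  rewrite E; apply: continuous_cvg; [exact: Lc | exact: df].
split; [by apply/cvg_ex; exists (L ('D_v f x)) | exact: cvg_lim].
Qed.

(** Two functions that agree on an open set have the same germs, hence the same
    directional derivatives, at each of its points. *)
Lemma Ck_ext (W : normedModType R) (m : nat) (U : set V) (f g : V -> W) :
  open U -> (forall x, U x -> f x = g x) -> Ck m U f -> Ck m U g.
Proof.
move=> Uo; elim: m f g => [|m IH] f g fg /= [cf df].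
  split=> // x Ux; suff : g @ x --> g x by []; rewrite -(fg x Ux).
  apply: cvg_trans (cf x Ux); apply: near_eq_cvg.
  by near do apply: fg; exact: open_nbhs_nbhs.
have nfg x : U x -> \forall y \near x, f y = g y.
  by move=> Ux; near do apply: fg; exact: open_nbhs_nbhs.
split=> [x Ux|v].
  suff : g @ x --> g x by []; rewrite -(fg x Ux).
  by apply: cvg_trans (cf x Ux); apply: near_eq_cvg; exact: nfg.
have [dfv Cf] := df v; split.
  move=> x Ux.
  apply: near_eq_derivable (dfv x Ux) => //; exact: nfg.
by apply: IH Cf => x Ux; apply: near_eq_derive; exact: nfg.
Unshelve. all: by end_near. Qed.

Lemma Ck_comp_linear (W W' : normedModType R) (L : {linear W -> W'}) (m : nat)
    (U : set V) (f : V -> W) :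
  continuous L -> open U -> Ck m U f -> Ck m U (L \o f).
Proof.
move=> Lc Uo; elim: m f => [|m IH] f /= [cf df].
  by split=> // x Ux; apply: continuous_comp; [exact: cf | exact: Lc].
split=> [x Ux|v]; first by apply: continuous_comp; [exact: cf | exact: Lc].
have [dfv Cf] := df v; split=> [x Ux|].
  by have [] := is_derive_comp_linear Lc (dfv x Ux).
apply: Ck_ext (IH _ Cf) => // x Ux.
by have [_ ->] := is_derive_comp_linear Lc (dfv x Ux).
Qed.

Lemma line_nbhs (U : set V) (a v : V) :
  nbhs a U -> \forall t \near (0 : R), U (t *: v + a).
Proof.
move=> Ua.
have : (fun t : R => t *: v + a) @ (0 : R) --> (a : V).
  rewrite -[X in _ --> X]add0r -[X in _ --> X + _](scale0r v).
  by apply: cvgD; [apply: cvgZr_tmp; exact: cvg_id | exact: cvg_cst].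
exact.
Qed.

Lemma derive_mvt (f : V -> R) (a v : V) (t : R) :
  0 < t ->
  (forall s, 0 <= s <= t -> derivable f (s *: v + a) v) ->
  exists2 s, 0 < s < t & f (t *: v + a) - f a = t * 'D_v f (s *: v + a).
Proof.
move=> t0 df.
have H s : s \in `]0, t[%R ->
    is_derive s 1 (fun s : R => f (s *: v + a)) ('D_v f (s *: v + a)).
  rewrite in_itv /= => /andP[s0 st].
  by apply: is_derive_line; apply: df; rewrite !ltW.
have C : {within `[0, t], continuous (fun s : R => f (s *: v + a))}.
  apply: derivable_within_continuous => s; rewrite in_itv /= => st.
  by have [] := is_derive_line (df s st).
have [s] := MVT t0 H C; rewrite in_itv /= => st E.
by exists s => //; move: E; rewrite scale0r add0r subr0 mulrC.
Qed.

End Calculus.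

(** * Second directional derivatives and minima *)

Section SecondOrder.
Variables (R : realType) (V : normedModType R).

Lemma plane_nbhs (A : set V) (x v w : V) : nbhs x A ->
  exists2 d : R, 0 < d &
    forall h s : R, `|h| < d -> `|s| < d -> A (s *: w + (h *: v + x)).
Proof.
move=> /nbhs_ballP[r /= r0 rA].
have D0 : 0 < `|w| + `|v| + 1 by rewrite ltr_wpDl // addr_ge0.
exists (r / (`|w| + `|v| + 1)); first exact: divr_gt0.
move=> h s hd sd; apply: rA; rewrite -ball_normE /= distrC addrA addrK.
apply: le_lt_trans (ler_normD _ _) _; rewrite !normrZ.
rewrite !ltr_pdivlMr // in hd sd.
have := normr_ge0 v; have := normr_ge0 w.
have [m0|] := leP `|h| `|s|; have := normr_ge0 h; have := normr_ge0 s; nra.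
Qed.

(** Along v + w, the increment of f splits as a step along v followed by a step
    along w from the displaced point; the mean value theorem turns the second
    one into a value of D_w f near x, and continuity of D_w f concludes.
    Derivability along v + w is assumed, so only positive steps matter. *)
Lemma deriveDdir (U : set V) (f : V -> R) (x v w : V) :
  open U -> U x -> (forall u y, U y -> derivable f y u) ->
  {for x, continuous ('D_w f)} ->
  'D_(v + w) f x = 'D_v f x + 'D_w f x.
Proof.
move=> Uo Ux df cf; apply/eqP; rewrite -subr_eq0 -normr_le0.
apply/ler_addgt0Pl => e e0; rewrite addr0.
have e30 : 0 < e / 3 by rewrite divr_gt0.
have /plane_nbhs : nbhs x (U `&` [set y | `|'D_w f x - 'D_w f y| < e / 3]).
  apply: filterI; first exact: open_nbhs_nbhs.
  by move/cvgrPdist_lt : cf => /(_ _ e30).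
move=> /(_ v w)[d d0 dA].
have Q u : \forall h \near (0 : R)^'+,
    `|'D_u f x - h^-1 *: (f (h *: u + x) - f x)| < e / 3.
  by have /cvg_dnbhs_at_right/cvgrPdist_lt /(_ _ e30) := df u x Ux.
have : \forall h \near (0 : R)^'+, [/\ 0 < h, h < d,
    `|'D_v f x - h^-1 *: (f (h *: v + x) - f x)| < e / 3 &
    `|'D_(v + w) f x - h^-1 *: (f (h *: (v + w) + x) - f x)| < e / 3].
  near=> h; split; near: h; [| |exact: Q|exact: Q].
  - exact: nbhs_right_gt.
  - exact: nbhs_right_lt.
move=> /filter_ex [h [h0 hd qv qvw]].
have ht s : 0 <= s <= h -> `|s| < d.
  by case/andP=> s0 sh; rewrite ger0_norm // (le_lt_trans sh).
have hh : `|h| < d by rewrite gtr0_norm.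
have [s /andP[s0 sh] E] : exists2 s, 0 < s < h &
    f (h *: w + (h *: v + x)) - f (h *: v + x)
      = h * 'D_w f (s *: w + (h *: v + x)).
  by apply: derive_mvt => // s /ht sd; apply: df; have [] := dA _ _ hh sd.
have [|_ /= qw] := dA h s hh; first by apply: ht; rewrite !ltW.
have {}E : h^-1 *: (f (h *: (v + w) + x) - f x) =
    'D_w f (s *: w + (h *: v + x)) + h^-1 *: (f (h *: v + x) - f x).
  rewrite -[X in _ = X + _](mulKf (lt0r_neq0 h0)) -E -scalerDr subrKA.
  by rewrite [h *: (v + w)]scalerDr [_ + h *: w]addrC -[_ + _ + x]addrA.
move: qvw; rewrite E => qvw.
move: qv qvw qw; move: (h^-1 *: _) ('D_w f (_ + _)) => a b.
rewrite !ltr_norml => /andP[? ?] /andP[? ?] /andP[? ?].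
rewrite ler_norml; apply/andP; split; lra.
Unshelve. all: by end_near. Qed.

(** The line through x with velocity c v is the one with velocity v, run at
    speed c. *)
Lemma deriveZdir (f : V -> R) (x v : V) (c : R) :
  derivable f x v -> 'D_(c *: v) f x = c * 'D_v f x.
Proof.
move=> df.
have dl : is_derive (0 * c : R) 1 (fun s : R => f (s *: v + x)) ('D_v f x).
  rewrite mul0r -[x in 'D_v f x]add0r -[X in 'D_v f (X + _)](scale0r v).
  by apply: is_derive_line; rewrite scale0r add0r.
have dg : is_derive (0 : R) 1 ( *%R^~ c) c.
  by apply: is_derive_eq; rewrite scaler0 add0r [LHS]mulr1.
have [_ E] := is_derive1_comp (g := *%R^~ c) dl dg.
rewrite mulrC -E.
rewrite /derive; apply: (f_equal (fun q : R -> R => lim (q @ 0^'))).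
apply/funext => h /=.
by rewrite scaler1 addr0 !mul0r scale0r add0r scalerA.
Qed.

Lemma derive_sum_dir (U : set V) (f : V -> R) (x v : V) (I : Type) (r : seq I)
    (c : I -> R) (e : I -> V) :
  open U -> Ck 1 U f -> U x -> v = \sum_(i <- r) c i *: e i ->
  'D_v f x = \sum_(i <- r) c i * 'D_(e i) f x.
Proof.
move=> Uo [_ Cf] Ux ->.
have df u y : U y -> derivable f y u by have [+ _] := Cf u; apply.
have cf u : {for x, continuous ('D_u f)}.
  by have [_ [+ _]] := Cf u; apply.
elim: r => [|i r IH]; first by rewrite !big_nil derive0.
rewrite !big_cons (deriveDdir _ Uo Ux df (cf _)) IH; congr (_ + _).
by apply: deriveZdir; exact: df.
Qed.

Lemma derive2_sum_dir (U : set V) (f : V -> R) (x v : V) (I : Type) (r : seq I)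
    (c : I -> R) (e : I -> V) :
  open U -> Ck 2 U f -> U x -> v = \sum_(i <- r) c i *: e i ->
  'D_v ('D_v f) x
    = \sum_(i <- r) \sum_(j <- r) c i * c j * 'D_(e i) ('D_(e j) f) x.
Proof.
move=> Uo Cf Ux vE.
have C1 u : Ck 1 U ('D_u f) by have [_ /(_ u) []] := Cf.
have C1f : Ck 1 U f.
  have [cf df] := Cf; split=> // u; have [du [cu _]] := df u.
  by split.
have -> : 'D_v ('D_v f) x = 'D_v (fun y => \sum_(j <- r) c j * 'D_(e j) f y) x.
  apply: near_eq_derive; near do apply: (derive_sum_dir Uo C1f _ vE).
  exact: open_nbhs_nbhs.
have -> : 'D_v (fun y => \sum_(j <- r) c j * 'D_(e j) f y) x
    = \sum_(j <- r) c j * 'D_v ('D_(e j) f) x.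
  have dc j u : is_derive x u (fun y => c j * 'D_(e j) f y) (c j * 'D_u ('D_(e j) f) x).
    have [_ /(_ u) [dj _]] := C1 (e j).
    by apply: is_deriveZ; apply: derivableP; exact: dj.
  suff S s : is_derive x v (fun y => \sum_(j <- s) c j * 'D_(e j) f y)
     (\sum_(j <- s) c j * 'D_v ('D_(e j) f) x) by have [] := S r.
  elim: s => [|j s IH].
    rewrite big_nil (_ : (fun _ => _) = cst 0); first exact: is_derive_cst.
    by apply/funext => y; rewrite big_nil.
  rewrite big_cons (_ : (fun _ => _) = (fun y => c j * 'D_(e j) f y)
    + (fun y => \sum_(j <- s) c j * 'D_(e j) f y)); first exact: is_deriveD.
  by apply/funext => y; rewrite big_cons.
rewrite exchange_big; apply: eq_bigr => j _.
rewrite (derive_sum_dir Uo (C1 _) Ux vE) mulr_sumr.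
by apply: eq_bigr => i _; rewrite mulrA [c j * _]mulrC.
Unshelve. all: by end_near. Qed.

Lemma derive_at_min (U : set V) (f : V -> R) (x v : V) :
  open U -> U x -> (forall y, U y -> derivable f y v) ->
  (forall y, U y -> f x <= f y) -> 'D_v f x = 0.
Proof.
move=> Uo Ux df fmin.
have /nbhs_ballP [r /= r0 rU] : nbhs (0 : R) [set t | U (t *: v + x)].
  by apply: line_nbhs; exact: open_nbhs_nbhs.
have inU t : t \in `]-r, r[%R -> U (t *: v + x).
  rewrite in_itv /= -ltr_norml => tr; apply: rU.
  by rewrite -ball_normE /= sub0r normrN.
have I0 : (0 : R) \in `]-r, r[%R by rewrite in_itv /= oppr_lt0 r0.
have H := is_derive_line (df _ (inU _ I0)).
have [|||_ E] := derive1_at_min (f := fun t : R => f (t *: v + x)) _ _ I0.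
- by rewrite ltW // (lt_trans _ r0) // oppr_lt0.
- by move=> t /inU/df/is_derive_line [].
- by move=> t /inU/fmin; rewrite scale0r add0r.
by have [_] := H; rewrite E scale0r add0r.
Qed.

(** A negative second derivative would make D_v f negative at all small
    positive times, since D_v f vanishes at x; by the mean value theorem f would
    then fall below f x. *)
Lemma derive2_at_min (U : set V) (f : V -> R) (x v : V) :
  open U -> U x -> (forall y, U y -> derivable f y v) ->
  derivable ('D_v f) x v ->
  (forall y, U y -> f x <= f y) -> 0 <= 'D_v ('D_v f) x.
Proof.
move=> Uo Ux df ddf fmin; rewrite leNgt; apply/negP => neg.
have D0 := derive_at_min Uo Ux df fmin.
have e0 : 0 < - 'D_v ('D_v f) x by rewrite oppr_gt0.
have /nbhs_ballP [r /= r0 rU] : nbhs (0 : R) [set t | U (t *: v + x)].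
  by apply: line_nbhs; exact: open_nbhs_nbhs.
have dd : h^-1 *: ('D_v f (h *: v + x) - 'D_v f x) @[h --> (0 : R)^']
    --> ('D_v ('D_v f) x : R) by exact: ddf.
move/cvgrPdist_lt/(_ _ e0)/nbhs_ballP : dd => [r' /= r'0 rD].
(* Half of each radius keeps the closed interval [0, t] in both open balls. *)
pose t := Num.min (r / 2) (r' / 2).
have t0 : 0 < t by rewrite lt_min !divr_gt0.
have tr s : 0 <= s <= t -> s < r /\ s < r'.
  rewrite le_min => /and3P[s0 sr sr']; split; lra.
have [|s /andP[s0 st] E] := @derive_mvt _ _ f x v t t0.
  move=> s st; apply/df/rU; have [sr _] := tr s st.
  by rewrite -ball_normE /= sub0r normrN ger0_norm //; case/andP: st.
have [sr sr'] : s < r /\ s < r' by apply: tr; rewrite !ltW.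
have : 0 <= t * 'D_v f (s *: v + x).
  rewrite -E subr_ge0; apply/fmin/rU; have [tr1 _] : t < r /\ t < r'.
    by apply: tr; rewrite lexx ltW.
  by rewrite -ball_normE /= sub0r normrN gtr0_norm.
rewrite pmulr_rge0 // => D1.
have := rD s; rewrite -ball_normE /= sub0r normrN gtr0_norm // => /(_ sr').
move=> /(_ (lt0r_neq0 s0)); rewrite D0 subr0 ltr_norml => /andP[+ _].
have q0 : 0 <= s^-1 *: ('D_v f (s *: v + x) : R^o).
  by apply: mulr_ge0 => //; rewrite invr_ge0 ltW.
rewrite opprK /= => lt; have := lt; rewrite ltrDl oppr_gt0.
by rewrite ltNge q0.
Qed.

End SecondOrder.

(** * Orthonormal frames and traces *)

Section Frames.
Variables (R : realFieldType) (n d : nat) (D : 'M[R]_(n, d)).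

(** The orthogonal projection of R^d onto the row space of D, acting on row
    vectors, when the rows of D are independent. *)
Definition row_proj : 'M[R]_d := D^T *m invmx (D *m D^T) *m D.

Hypothesis gU : D *m D^T \in unitmx.

Lemma trmx_row_proj : row_proj^T = row_proj.
Proof. by rewrite !trmx_mul trmx_inv trmx_mul !trmxK mulmxA. Qed.

Lemma mul_row_proj : D *m row_proj = D.
Proof. by rewrite !mulmxA mulmxV // mul1mx. Qed.

Lemma row_proj_idem : row_proj *m row_proj = row_proj.
Proof. by rewrite {1}/row_proj -mulmxA mul_row_proj. Qed.

Lemma mxtrace_row_proj : \tr row_proj = n%:R.
Proof. by rewrite /row_proj -mulmxA mxtrace_mulC -mulmxA mulVmx // mxtrace1. Qed.

(** The diagonal entries of a symmetric idempotent are the squared norms of its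
    rows; if they sum to zero, every row vanishes. *)
Lemma sym_idem_trace0 (E : 'M[R]_d) :
  E^T = E -> E *m E = E -> \tr E = 0 -> E = 0.
Proof.
move=> Es Ei Et; have Ed i : E i i = \sum_j E i j ^+ 2.
  rewrite -{1}Ei mxE; apply: eq_bigr => j _.
  by rewrite -{2}Es mxE -expr2.
have E0 i : 0 <= E i i by rewrite Ed sumr_ge0 // => j _; exact: sqr_ge0.
apply/matrixP => i j; rewrite mxE; apply/eqP.
have /eqP := Et; rewrite psumr_eq0 // => /allP /(_ i).
rewrite mem_index_enum => /(_ isT) /=; rewrite Ed psumr_eq0; last first.
  by move=> k _; exact: sqr_ge0.
by move=> /allP /(_ j); rewrite mem_index_enum sqrf_eq0; apply.
Qed.

(** The sum on the left is an orthogonal projection of trace n + 2, so its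
    complement is a symmetric idempotent of trace zero.  Counting traces
    replaces a rank argument. *)
Lemma frame_resolution (N Y : 'rV[R]_d) :
  d = n.+2 ->
  D *m N^T = 0 -> D *m Y^T = 0 -> Y *m N^T = 0 ->
  N *m N^T = 1%:M -> Y *m Y^T = 1%:M ->
  row_proj + N^T *m N + Y^T *m Y = 1%:M.
Proof.
move=> dn DN DY YN NN YY; apply/esym/eqP; rewrite -subr_eq0; apply/eqP.
have oE (u v : 'rV[R]_d) : u *m v^T = 0 -> (u^T *m u) *m (v^T *m v) = 0.
  by move=> uv; rewrite -mulmxA (mulmxA u) uv mul0mx mulmx0.
have iE (u : 'rV[R]_d) :
    u *m u^T = 1%:M -> (u^T *m u) *m (u^T *m u) = u^T *m u.
  by move=> uu; rewrite -mulmxA (mulmxA u) uu mul1mx.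
have QE (u : 'rV[R]_d) : D *m u^T = 0 -> row_proj *m (u^T *m u) = 0.
  by move=> Du; rewrite mulmxA -(mulmxA _ D) Du mulmx0 mul0mx.
have EQ (u : 'rV[R]_d) : D *m u^T = 0 -> (u^T *m u) *m row_proj = 0.
  by move=> Du; rewrite -[LHS]trmxK trmx_mul trmx_row_proj (trmx_mul u^T u) trmxK QE ?trmx0.
have NY : N *m Y^T = 0 by rewrite -[LHS]trmxK trmx_mul trmxK YN trmx0.
set S := _ + _ + _.
have SS : S *m S = S.
  rewrite /S !mulmxDl !mulmxDr row_proj_idem !iE // !oE // !QE // !EQ //.
  by rewrite !addr0 !add0r.
have St : S^T = S.
  by rewrite /S !linearD /= trmx_row_proj !trmx_mul !trmxK.
apply: sym_idem_trace0.
- by rewrite linearB /= trmx1 St.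
- by rewrite mulmxBl !mulmxBr !mulmx1 mul1mx SS subrr subr0.
- rewrite linearB /= mxtrace1 /S !linearD /= mxtrace_row_proj.
  rewrite mxtrace_mulC NN mxtrace_mulC YY !mxtrace1 dn -addn2 natrD.
  by ring.
Qed.

(** With B := D^T g^-1 and g := D D^T, the identity B^T B = g^-1 makes this
    trace the sum of the values of the quadratic form S at the rows of B. *)
Lemma trace_psd_ge0 (S : 'M[R]_n) :
  (forall v : 'rV[R]_n, 0 <= (v *m S *m v^T) 0 0) ->
  0 <= \tr (invmx (D *m D^T) *m S).
Proof.
move=> psd; set g := D *m D^T.
have -> : \tr (invmx g *m S) = \tr (D^T *m invmx g *m S *m (D^T *m invmx g)^T).
  rewrite trmx_mul trmx_inv trmxK (_ : g^T = g); last first.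
    by rewrite trmx_mul trmxK.
  by rewrite -!mulmxA [RHS]mxtrace_mulC -!mulmxA mulVmx // mulmx1.
apply: sumr_ge0 => i _; have := psd (row i (D^T *m invmx g)).
congr (_ <= _); rewrite -row_mul !mxE; apply: eq_bigr => j _.
by rewrite !mxE.
Qed.

End Frames.

Section Core.
Variables (R : rcfType) (n a b : nat).
Local Notation d := (a + b)%N.

(** The linear algebra at a minimum of |x|^2 on a hypersurface: D holds the first
    derivatives of the immersion, T the second ones, x and y the flat and the
    spherical part of the position.  The last hypothesis is the nonnegativity
    of half the Hessian of |x|^2, and the trace in the previous one is that of
    the second fundamental form, so it says H = lam / 2. *)
Lemma min_trace_bound (D : 'M[R]_(n, d)) (T : 'I_n -> 'I_n -> 'rV[R]_d)
    (N x y : 'rV[R]_d) (lam : R) :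
  d = n.+2 -> D *m D^T \in unitmx ->
  (forall l : 'I_b, x 0 (rshift a l) = 0) ->
  (forall l : 'I_a, y 0 (lshift b l) = 0) -> 0 < (y *m y^T) 0 0 ->
  D *m N^T = 0 -> D *m y^T = 0 -> y *m N^T = 0 -> N *m N^T = 1%:M ->
  D *m x^T = 0 -> (x *m N^T) 0 0 = lam ->
  - \tr (invmx (D *m D^T) *m \matrix_(i, j) (T i j *m N^T) 0 0) = lam / 2 ->
  (forall v : 'rV[R]_n, 0 <= \sum_(l < a) (\sum_i v 0 i * D i (lshift b l)) ^+ 2
     + \sum_i \sum_j v 0 i * v 0 j * (T i j *m x^T) 0 0) ->
  lam ^+ 2 / 2 + \sum_(l < a) N 0 (lshift b l) ^+ 2 <= a%:R.
Proof.
move=> dn gU x2 y1 yy DN Dy yN NN Dx xN trA psd.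
pose s := Num.sqrt ((y *m y^T) 0 0); pose Y := s^-1 *: y.
have s0 : s != 0 by rewrite sqrtr_eq0 -ltNge.
have YY : Y *m Y^T = 1%:M.
  rewrite /Y linearZ /= -scalemxAl -scalemxAr scalerA [y *m y^T]mx11_scalar.
  rewrite -(sqr_sqrtr (ltW yy)) -/s scale_scalar_mx; congr (_%:M).
  by rewrite -invfM -expr2 mulVf // sqrf_eq0.
have DY : D *m Y^T = 0 by rewrite /Y linearZ /= -scalemxAr Dy scaler0.
have YN : Y *m N^T = 0 by rewrite /Y -scalemxAl yN scaler0.
have res := frame_resolution gU dn DN DY YN NN YY.
have xY : x *m Y^T = 0.
  rewrite /Y linearZ /= -scalemxAr [x *m _]mx11_scalar mxE big_split_ord /=.
  rewrite big1 => [|l _]; last by rewrite mxE y1 mulr0.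
  rewrite big1 => [|l _]; last by rewrite x2 mul0r.
  by rewrite addr0 scale_scalar_mx mulr0 raddf0.
have xQ : x *m row_proj D = 0.
  by rewrite -[x]trmxK -(trmx_row_proj D) -trmx_mul -mulmxA Dx mulmx0 trmx0.
(* x is orthogonal to the tangent space and to y, so only its N part is left. *)
have xE : x = lam *: N.
  rewrite -[LHS]mulmx1 -res !mulmxDr xQ add0r !mulmxA xY mul0mx addr0.
  by rewrite [x *m N^T]mx11_scalar xN mul_scalar_mx.
pose g := D *m D^T; pose A := \matrix_(i, j) (T i j *m N^T) 0 0.
pose S := lsubmx D *m (lsubmx D)^T + lam *: A.
have S_psd (v : 'rV[R]_n) : 0 <= (v *m S *m v^T) 0 0.
  have := psd v; congr (_ <= _).
  rewrite /S mulmxDr mulmxDl [RHS]mxE; congr (_ + _).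
    rewrite mulmxA -mulmxA -trmx_mul mxE; apply: eq_bigr => l _.
    rewrite [X in _ = _ * X]mxE -expr2 mxE.
    by congr (_ ^+ 2); apply: eq_bigr => i _; rewrite mxE.
  rewrite [RHS]mxE exchange_big; apply: eq_bigr => j _; rewrite mxE mulr_suml.
  apply: eq_bigr => i _; rewrite xE linearZ /= -scalemxAr !mxE.
  by ring.
have := trace_psd_ge0 gU S_psd.
rewrite /S mulmxDr linearD /= -scalemxAr linearZ /= -/g.
have -> : \tr (invmx g *m A) = - (lam / 2) by rewrite -trA opprK.
have -> : \tr (invmx g *m (lsubmx D *m (lsubmx D)^T))
    = a%:R - \sum_(l < a) N 0 (lshift b l) ^+ 2.
  rewrite mulmxA mxtrace_mulC trmx_lsub mul_usub_mx !mulmx_lsub.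
  rewrite mulmxA -/(row_proj D) -[in a%:R](card_ord a) -sum1_card.
  rewrite natr_sum -sumrB; apply: eq_bigr => l _; rewrite !mxE.
  have /matrixP /(_ (lshift b l) (lshift b l)) := res.
  rewrite !mxE eqxx !big_ord1 !mxE y1 mulr0 mul0r addr0 => <-.
  by rewrite expr2 addrK.
rewrite mulrN; lra.
Qed.
End Core.

(** * Coordinates of the ambient space *)

Section Flat.
Variables (R : realType) (a b : nat).

(** The ambient space as a single space of row vectors, which turns edot into a
    matrix product. *)
Definition flat (z : euc R a b) : 'rV[R]_(a + b) := row_mx z.1 z.2.

Lemma edot_flat (z w : euc R a b) : edot z w = (flat z *m (flat w)^T) 0 0.
Proof.
rewrite /edot /dot mxE big_split_ord /=; congr (_ + _);
  by apply: eq_bigr => i _; rewrite [_^T _ _]mxE ?row_mxEl ?row_mxEr.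
Qed.

(** The codomain is R^o, so that each coordinate is a linear form to which
    is_derive_comp_linear applies. *)
Definition ecoord (l : 'I_(a + b)) (z : euc R a b) : R^o := flat z 0 l.

Lemma ecoord_is_linear l : linear (ecoord l).
Proof.
move=> c z w; rewrite /ecoord /flat /= -add_row_mx -scale_row_mx.
by rewrite mxE [X in X + _]mxE.
Qed.

HB.instance Definition _ l :=
  GRing.isLinear.Build R (euc R a b) R^o *:%R (ecoord l) (ecoord_is_linear l).

Lemma ecoord_continuous l : continuous (ecoord l).
Proof.
rewrite -(splitK l); case: (fintype.split l) => j /= z.
  rewrite (_ : ecoord _ = (fun M : 'rV[R]_a => M 0 j) \o fst); last first.
    by apply/funext => w; rewrite /ecoord row_mxEl.
  by apply: continuous_comp; [exact: cvg_fst | exact: matrix_normedtype.coord_continuous].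
rewrite (_ : ecoord _ = (fun M : 'rV[R]_b => M 0 j) \o snd); last first.
  by apply/funext => w; rewrite /ecoord row_mxEr.
by apply: continuous_comp; [exact: cvg_snd | exact: matrix_normedtype.coord_continuous].
Qed.

Lemma is_derive_ecoord (V : normedModType R) (F : V -> euc R a b) l x v :
  derivable F x v ->
  is_derive x v (fun y => ecoord l (F y)) (ecoord l ('D_v F x)).
Proof. by move=> dF; apply: is_derive_comp_linear dF; exact: ecoord_continuous. Qed.

Lemma is_derive_sqsum (V : normedModType R) (m : nat) (f : 'I_m -> V -> R)
    (df : 'I_m -> R) x v :
  (forall l, is_derive x v (f l) (df l)) ->
  is_derive x v (fun y => \sum_(l < m) f l y ^+ 2)
    (\sum_(l < m) f l x * df l *+ 2).
Proof.
move=> H; rewrite (_ : (fun _ => _) = \sum_(l < m) (f l ^+ 2)); last first.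
  by apply/funext => y; rewrite fct_sumE.
apply: is_derive_eq; apply: eq_bigr => l _.
by rewrite expr1 /GRing.scale /= mulr2n; ring.
Qed.

Lemma euc_grad_potential (z : euc R a b) :
  euc_grad (@potential R a b) z = (2^-1 *: z.1, 0).
Proof.
have H v : 'D_v (@potential R a b) z = 2^-1 * dot z.1 v.1.
  have Hl (l : 'I_a) : is_derive z v (fun y : euc R a b => y.1 0 l) (v.1 0 l).
    have := is_derive_ecoord (lshift b l) (@derivable_id _ _ z v).
    rewrite derive_id {2}/ecoord row_mxEl; congr (is_derive _ _ _ _).
    by apply/funext => y; rewrite /ecoord row_mxEl.
  have [dp Dp] := is_derive_sqsum Hl.
  have -> : @potential R a b = (fun y => 4^-1 *: (\sum_(l < a) y.1 0 l ^+ 2 : R^o)).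
    by apply/funext => y; rewrite /potential /dot mulrC.
  rewrite deriveZ // Dp /dot scaler_sumr mulr_sumr; apply: eq_bigr => l _.
  by rewrite -[_ *: _]/(_ * _) mulr2n; field.
rewrite /euc_grad; congr (_, _); apply/rowP => i; rewrite !mxE H /=.
  rewrite /dot (bigD1 i) //= mxE !eqxx mulr1 big1 ?addr0 // => j ji.
  by rewrite mxE (negbTE ji) andbF mulr0.
by rewrite /dot big1 ?mulr0 // => j _; rewrite mxE mulr0.
Qed.

Lemma edot_grad_potential (z w : euc R a b) :
  edot (cyl_grad (@potential R a b) z) w = dot z.1 w.1 / 2.
Proof.
rewrite /cyl_grad euc_grad_potential /cyl_proj /edot /=.
have -> : dot (0 : 'rV[R]_b) z.2 = 0 by rewrite /dot big1 // => i _; rewrite mxE mul0r.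
rewrite mul0r scale0r subr0 [X in _ + X]/dot big1 ?addr0; last first.
  by move=> i _; rewrite mxE mul0r.
rewrite /dot mulr_suml; apply: eq_bigr => i _; rewrite mxE; ring.
Qed.

End Flat.

(** * Parametrized pieces of a hypersurface *)

Section Minimum.
Variables (R : realType) (n a b : nat).

Lemma edot_sum (z w : euc R a b) :
  edot z w = \sum_l ecoord l z * ecoord l w.
Proof. by rewrite edot_flat mxE; apply: eq_bigr => l _; rewrite [_^T _ _]mxE. Qed.

Lemma flat_inj : injective (@flat R a b).
Proof. by move=> [z1 z2] [w1 w2] /eq_row_mx /= [-> ->]. Qed.

Section Param.
Variables (U : set 'rV[R]_n) (F : 'rV[R]_n -> euc R a b) (u : 'rV[R]_n).
Hypotheses (Uo : open U) (Uu : U u) (CF : Ck 2 U F).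

(** The rows are the coordinate tangent vectors of F at u. *)
Definition tangent_mx : 'M[R]_(n, a + b) :=
  \matrix_(i, l) ecoord l ('D_(basis_vec R i) F u).

Definition hess (i j : 'I_n) : euc R a b :=
  'D_(basis_vec R i) (fun w => 'D_(basis_vec R j) F w) u.

Let f l y := ecoord l (F y).

Let dF v y : U y -> derivable F y v.
Proof. by have [_ /(_ v) [+ _]] := CF; apply. Qed.

Let ddF v w : derivable ('D_w F) u v.
Proof. by have [_ /(_ w) [_ [_ /(_ v) [+ _]]]] := CF; apply. Qed.

Let Cf l : Ck 2 U (f l).
Proof. exact: (Ck_comp_linear (@ecoord_continuous R a b l) Uo CF). Qed.

Let C1f l : Ck 1 U (f l).
Proof.
have [cf df] := Cf l; split=> // v; have [dv [cv _]] := df v.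
by split.
Qed.

Let df l v y : U y -> is_derive y v (f l) (ecoord l ('D_v F y)).
Proof. by move=> Uy; apply: is_derive_ecoord; exact: dF. Qed.

Let ddf l v w :
  is_derive u w ('D_v (f l)) (ecoord l ('D_w ('D_v F) u)).
Proof.
have := is_derive_ecoord l (@ddF w v); apply: near_eq_is_derive.
near=> y; have [//|_ ->//] := df l v (_ : U y).
by near: y; exact: open_nbhs_nbhs.
Unshelve. all: by end_near. Qed.

Lemma ecoord_derive l v :
  ecoord l ('D_v F u) = \sum_i v 0 i * tangent_mx i l.
Proof.
transitivity ('D_v (f l) u); first by case: (df l v Uu) => _ ->.
rewrite (derive_sum_dir Uo (C1f l) Uu (row_sum_delta v)).
by apply: eq_bigr => i _; rewrite mxE; case: (df l (delta_mx 0 i) Uu) => _ ->.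
Qed.

Lemma ecoord_derive2 l v :
  ecoord l ('D_v ('D_v F) u)
    = \sum_i \sum_j v 0 i * v 0 j * ecoord l (hess i j).
Proof.
transitivity ('D_v ('D_v (f l)) u).
  by case: (ddf l v v) => _ ->.
rewrite (derive2_sum_dir Uo (Cf l) Uu (row_sum_delta v)).
apply: eq_bigr => i _; apply: eq_bigr => j _; congr (_ * _).
by case: (ddf l (basis_vec R j) (basis_vec R i)) => _.
Qed.

Lemma tangent_mx_mul (w : euc R a b) i :
  (tangent_mx *m (flat w)^T) i 0 = edot ('D_(basis_vec R i) F u) w.
Proof.
rewrite edot_sum mxE; apply: eq_bigr => l _.
by rewrite [_^T _ _]mxE [tangent_mx _ _]mxE.
Qed.

Lemma tangent_mx_gram i j :
  (tangent_mx *m tangent_mx^T) i j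
    = edot ('D_(basis_vec R i) F u) ('D_(basis_vec R j) F u).
Proof.
rewrite edot_sum mxE; apply: eq_bigr => l _.
by rewrite [_^T _ _]mxE ![tangent_mx _ _]mxE.
Qed.

(** If v is in the kernel of the Gram matrix then |D_v F|^2 = 0, and an
    immersion has no tangent direction along which F is stationary. *)
Lemma tangent_mx_gram_unit :
  (forall v, 'D_v F u = 0 -> v = 0) -> tangent_mx *m tangent_mx^T \in unitmx.
Proof.
move=> imm; rewrite -row_free_unit; apply: inj_row_free => v vg.
apply: imm; apply: flat_inj; apply/rowP => l.
rewrite -[LHS]/(ecoord l _) ecoord_derive.
have : (v *m tangent_mx) *m (v *m tangent_mx)^T = 0.
  by rewrite trmx_mul mulmxA -(mulmxA v) vg mul0mx.
move/matrixP => /(_ 0 0); rewrite mxE [RHS]mxE => /eqP.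
rewrite psumr_eq0; last by move=> k _; rewrite [_^T _ _]mxE -expr2 sqr_ge0.
move=> /allP /(_ l); rewrite mem_index_enum => /(_ isT) /=.
rewrite [_^T _ _]mxE -expr2 sqrf_eq0 mxE => /eqP ->.
by rewrite -[RHS]/(ecoord l (0 : euc R a b)) linear0.
Qed.

Let is_derive_sqnorm (m : nat) (g : 'I_m -> 'I_(a + b)) v y : U y ->
  is_derive y v (fun y => \sum_(l < m) f (g l) y ^+ 2)
    (\sum_(l < m) f (g l) y * 'D_v (f (g l)) y *+ 2).
Proof.
move=> Uy; apply: is_derive_sqsum => l; apply: derivableP.
by have [] := df (g l) v Uy.
Qed.

(** Stated for the norm of a subfamily g of the coordinates; the coordinates of
    the spherical factor give the tangency of M to the cylinder. *)
Lemma sqnorm_const (m : nat) (g : 'I_m -> 'I_(a + b)) r v :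
  (forall y, U y -> \sum_(l < m) ecoord (g l) (F y) ^+ 2 = r) ->
  \sum_(l < m) ecoord (g l) (F u) * ecoord (g l) ('D_v F u) = 0.
Proof.
move=> H; have [_] := is_derive_sqnorm g v Uu.
rewrite (@near_eq_derive _ _ _ _ (cst r)) ?derive_cst; last first.
  near=> y; apply: H; near: y; exact: open_nbhs_nbhs.
rewrite sumrMnl => /esym/eqP; rewrite mulrn_eq0 /= => /eqP; apply: etrans.
by apply: eq_bigr => l _; have [_ ->] := df (g l) v Uu.
Unshelve. all: by end_near. Qed.

(** First and second order conditions at a minimum of half the squared norm of a
    subfamily of the coordinates; used for those of the flat factor. *)
Lemma sqnorm_min (m : nat) (g : 'I_m -> 'I_(a + b)) v :
  (forall y, U y -> \sum_(l < m) ecoord (g l) (F u) ^+ 2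
                 <= \sum_(l < m) ecoord (g l) (F y) ^+ 2) ->
  \sum_(l < m) ecoord (g l) (F u) * ecoord (g l) ('D_v F u) = 0 /\
  0 <= \sum_(l < m) ecoord (g l) ('D_v F u) ^+ 2
     + \sum_(l < m) ecoord (g l) (F u) * ecoord (g l) ('D_v ('D_v F) u).
Proof.
move=> H; pose phi y := \sum_(l < m) f (g l) y ^+ 2.
have dphi y : U y -> derivable phi y v.
  by move=> Uy; have [] := is_derive_sqnorm g v Uy.
split.
  have := derive_at_min Uo Uu dphi H; have [_ ->] := is_derive_sqnorm g v Uu.
  rewrite sumrMnl => /eqP; rewrite mulrn_eq0 /= => /eqP; apply: etrans.
  by apply: eq_bigr => l _; have [_ ->] := df (g l) v Uu.
have aux (s t w : R) : 2 * (s * t + w * w) = (w ^+ 2 + s * t) *+ 2.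
  by rewrite mulr2n; ring.
have dd : is_derive u v ('D_v phi)
    (\sum_(l < m) (ecoord (g l) ('D_v F u) ^+ 2
        + ecoord (g l) (F u) * ecoord (g l) ('D_v ('D_v F) u)) *+ 2).
  have E : {near u, (fun y => \sum_(l < m) f (g l) y * 'D_v (f (g l)) y *+ 2)
     =1 'D_v phi}.
    near=> y; have [//|_ ->//] := is_derive_sqnorm g v (_ : U y).
    by near: y; exact: open_nbhs_nbhs.
  apply: near_eq_is_derive E _.
  rewrite (_ : (fun _ => _) = \sum_(l < m) (2 *: (f (g l) * 'D_v (f (g l))))).
    have D1 l := df (g l) v Uu; have D2 l := @ddf (g l) v v.
    apply: is_derive_eq; apply: eq_bigr => l _.
    have [_ ->] := D1 l; exact: aux.
  apply/funext => y; rewrite fct_sumE; apply: eq_bigr => l _.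
  by rewrite -mulr_natl.
have [d2 E2] := dd; have := derive2_at_min Uo Uu dphi d2 H.
rewrite E2 sumrMnl pmulrn_lge0 //.
by rewrite -big_split.
Unshelve. all: by end_near. Qed.

End Param.
End Minimum.

(** * Existence of a point closest to the axis *)

Section Properness.
Variables (R : realType) (n a b : nat) (M : smooth_manifold R n).

(** Near p, the map F factors through the chart at p. *)
Lemma smooth_map_continuous (W : normedModType R) (F : M -> W) :
  smooth_map F -> continuous F.
Proof.
move=> sF p; set c := chart_at p; have cp : chart_dom c p := chart_at_dom p.
have [cF _] := sF c (chart_at_atlas p) 0%N.
suff : F @ p --> F p by [].
rewrite -[in X in _ --> X](chart_mapK cp).
have: (F \o chart_inv c) \o chart_map c @ p --> F (chart_inv c (chart_map c p)).
  apply: continuous_comp; first exact: chart_map_cont.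
  by apply: cF; exists p.
apply: cvg_trans; apply: near_eq_cvg; near=> q.
by rewrite /= chart_mapK //; near: q; apply: open_nbhs_nbhs; split => //;
   exact: chart_dom_open.
Unshelve. all: by end_near. Qed.

Lemma dot_continuous m : continuous (fun x : 'rV[R]_m => dot x x).
Proof.
apply: (@continuous_big R 'I_m +%R 0 predT) => [|i _ x].
  exact: add_continuous.
have cx := @matrix_normedtype.coord_continuous R 1 m 0 i x.
exact: (cvgM cx cx).
Qed.

Lemma dot_preimage_compact m (E : set R) (C : R) :
  closed E -> (forall t, E t -> t <= C) ->
  compact [set x : 'rV[R]_m | E (dot x x)].
Proof.
move=> Ecl EC; apply: bounded_closed_compact; last first.
  by apply: preimage_closed => // x _; exact: dot_continuous.
exists (C + 1); split; first exact: num_real.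
move=> t Ct x /EC xC /=; rewrite [leLHS]/Num.Def.normr /= mx_normrE.
have x0 : 0 <= dot x x by apply: sumr_ge0 => i _; rewrite -expr2 sqr_ge0.
apply: bigmax_le => [|[i j] _ /=]; first lra.
rewrite ord1; have : x 0 j ^+ 2 <= C.
  apply: le_trans xC; rewrite /dot (bigD1 j) //= -expr2 lerDl.
  by apply: sumr_ge0 => k _; rewrite -expr2 sqr_ge0.
rewrite -real_normK ?num_real //; have := normr_ge0 (x 0 j); nra.
Qed.

(** The part of the cylinder not farther from the axis than X p0 is the product
    of a closed ball and a sphere, hence compact. *)
Lemma proper_attains_min (rho : R) (X : M -> euc R a b) :
  [set: M] !=set0 -> continuous X -> (forall p, cylinder rho (X p)) ->
  proper_into (cylinder rho) X ->
  exists p, forall q, dot (X p).1 (X p).1 <= dot (X q).1 (X q).1.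
Proof.
move=> [p0 _] Xc Xcyl Xprop.
set C := dot (X p0).1 (X p0).1.
pose K : set (euc R a b) :=
  [set x | dot x x <= C] `*` [set y | Num.sqrt (dot y y) = rho].
have Kc : compact K.
  apply: compact_setX.
    by apply: (@dot_preimage_compact _ [set t | t <= C] C); first exact: closed_le.
  apply: (@dot_preimage_compact _ [set t | Num.sqrt t = rho] (rho ^+ 2)).
    apply: (@preimage_closed _ _ Num.sqrt [set rho]) => [t _|].
      exact: sqrt_continuous.
    exact: closed_eq.
  move=> t /= <-; have [t0|t0] := leP 0 t; first by rewrite sqr_sqrtr.
  by rewrite (le_trans (ltW t0)) // sqr_ge0.
have Pc : compact (X @^-1` K) by apply: Xprop => // z [].
have phic : continuous (fun p => dot (X p).1 (X p).1).
  move=> p.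
  apply: (@continuous_comp _ _ _ X (fun z : euc R a b => dot z.1 z.1)).
    exact: Xc.
  apply: (@continuous_comp _ _ _ fst (fun x => dot x x)).
    exact: cvg_fst.
  exact: dot_continuous.
have P0 : X @^-1` K !=set0 by exists p0; split => /=; [exact: lexx|exact: Xcyl].
have [p pK pmin] := compact_EVT_min P0 Pc (continuous_subspaceT phic).
move: pK; rewrite inE => -[/= pK _].
exists p => q; have [qC|/ltW Cq] := leP (dot (X q).1 (X q).1) C.
  by apply: pmin; rewrite inE; split => //=; exact: Xcyl.
exact: le_trans pK Cq.
Qed.

End Properness.

(** * The mean curvature at a closest point *)

Section Bound.
Variables (R : realType) (n a b : nat) (M : smooth_manifold R n).

(** The projection onto the tangent space of the cylinder removes a multiple of
    the radial vector, which is orthogonal to v.  With v the normal, this frees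
    the second fundamental form from the projection in the covariant
    derivative. *)
Lemma edot_cyl_proj (z w v : euc R a b) :
  cyl_tangent z v -> edot (cyl_proj z w) v = edot w v.
Proof.
rewrite /cyl_tangent /edot /cyl_proj /= => zv; congr (_ + _).
set t := _ / _; transitivity (dot w.2 v.2 - t * dot v.2 z.2); last first.
  by rewrite zv mulr0 subr0.
rewrite /dot mulr_sumr -sumrB; apply: eq_bigr => i _.
by rewrite !mxE; ring.
Qed.

(** At a point closest to the axis, the nonnegative Laplacian of |x|^2 / 2 equals
    a - |N1|^2 - 2 H^2. *)
Lemma mean_curvature_bound_at_min (rho : R) (X N : M -> euc R a b) (p : M) :
  (a + b = n.+2)%N -> 0 < rho -> (forall p, cylinder rho (X p)) ->
  immersion X -> unit_normal X N -> f_minimal (@potential R a b) X N ->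
  (forall q, dot (X p).1 (X p).1 <= dot (X q).1 (X q).1) ->
  2 * mean_curvature X N p ^+ 2 + dot (N p).1 (N p).1 <= a%:R.
Proof.
move=> abn rho0 Xcyl [Xs Xi] [Ns Nt N1 NX] Xmin pmin.
set c := chart_at p; have cA : atlas c := chart_at_atlas p.
have cp : chart_dom c p := chart_at_dom p.
set u := chart_map c p; pose U := chart_img c; pose F := X \o chart_inv c.
have Uo : open U := @chart_img_open _ _ _ c.
have Uu : U u by exists p.
have CF : Ck 2 U F by exact: Xs.
have Fu : F u = X p by rewrite /F /= chart_mapK.
set D := tangent_mx F u.
set lam := dot (X p).1 (N p).1.
have HE : mean_curvature X N p = lam / 2.
  have := Xmin p; rewrite /weighted_mean_curvature edot_grad_potential.
  by move/eqP; rewrite subr_eq0 => /eqP.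
have edotC (z w : euc R a b) : edot z w = edot w z.
  by rewrite !edot_sum; apply: eq_bigr => l _; rewrite mulrC.
have gE : metric_mx X c p = D *m D^T.
  apply/matrixP => i j; rewrite /metric_mx mxE /D tangent_mx_gram.
  reflexivity.
have gU : D *m D^T \in unitmx.
  exact: (tangent_mx_gram_unit Uo Uu CF (Xi c cA u Uu)).
have dotC m (v w : 'rV[R]_m) : dot v w = dot w v.
  by apply: eq_bigr => l _; rewrite mulrC.
(* The position splits into its component along the axis and the radial vector
   of the sphere. *)
pose x : euc R a b := ((X p).1, 0); pose y : euc R a b := (0, (X p).2).
have yE z : edot z y = dot z.2 (X p).2.
  rewrite /edot /= [X in X + _]/dot big1 ?add0r // => i _.
  by rewrite mxE mulr0.
have xE z : edot z x = dot z.1 (X p).1.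
  rewrite /edot /= [X in _ + X]/dot big1 ?addr0 // => i _.
  by rewrite mxE mulr0.
have p1 (z w : euc R a b) :
    \sum_(l < a) ecoord (lshift b l) z * ecoord (lshift b l) w
    = dot z.1 w.1.
  by apply: eq_bigr => l _; rewrite /ecoord !row_mxEl.
have p2 (z w : euc R a b) :
    \sum_(l < b) ecoord (rshift a l) z * ecoord (rshift a l) w
    = dot z.2 w.2.
  by apply: eq_bigr => l _; rewrite /ecoord !row_mxEr.
have sq1 (z : euc R a b) :
    \sum_(l < a) ecoord (lshift b l) z ^+ 2 = dot z.1 z.1.
  by rewrite -p1; apply: eq_bigr => l _; rewrite expr2.
have sq2 (z : euc R a b) :
    \sum_(l < b) ecoord (rshift a l) z ^+ 2 = dot z.2 z.2.
  by rewrite -p2; apply: eq_bigr => l _; rewrite expr2.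
have cyl2 q : dot (X q).2 (X q).2 = rho ^+ 2.
  rewrite -(Xcyl q) sqr_sqrtr // -sq2; apply: sumr_ge0 => l _.
  exact: sqr_ge0.
have Fmin v : dot (X p).1 ('D_v F u).1 = 0 /\
    0 <= dot ('D_v F u).1 ('D_v F u).1 + dot (X p).1 ('D_v ('D_v F) u).1.
  have [|m1 m2] := sqnorm_min Uo Uu CF (g := @lshift a b) v.
    by move=> w Uw; rewrite !sq1 Fu; exact: pmin.
  move: ('D_v ('D_v F) u) ('D_v F u) m1 m2 => w2 w1.
  by rewrite Fu (p1 (X p) w1) (p1 (X p) w2) sq1.
have Ftan v : dot (X p).2 ('D_v F u).2 = 0.
  rewrite -Fu -p2; apply: (sqnorm_const Uo Uu CF (r := rho ^+ 2)) => w _.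
  by rewrite sq2; exact: cyl2.
have Dmul (w : euc R a b) : (forall v, edot ('D_v F u) w = 0) ->
    D *m (flat w)^T = 0.
  by move=> H; apply/matrixP => i j; rewrite ord1 tangent_mx_mul H mxE.
have yN : edot y (N p) = 0.
  by rewrite edotC yE; exact: Nt.
have hE i j : edot (cov_deriv X c p i j) (N p) = edot (hess F u i j) (N p).
  exact: edot_cyl_proj (Nt p).
have yy : 0 < (flat y *m (flat y)^T) 0 0.
  by rewrite -edot_flat yE cyl2 exprn_gt0.
have mx1 (z w : euc R a b) t : edot z w = t -> flat z *m (flat w)^T = t%:M.
  by move=> zw; rewrite [LHS]mx11_scalar -edot_flat zw.
have Nc : N p = N (chart_inv c u) by rewrite chart_mapK.
have DN : D *m (flat (N p))^T = 0.
  by apply: Dmul => v; rewrite Nc; apply: NX.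
have Dy : D *m (flat y)^T = 0.
  by apply: Dmul => v; rewrite yE dotC; exact: Ftan.
have Dx : D *m (flat x)^T = 0.
  by apply: Dmul => v; rewrite xE dotC; case: (Fmin v).
have yN' : flat y *m (flat (N p))^T = 0 by rewrite (mx1 _ _ _ yN) raddf0.
have xN : (flat x *m (flat (N p))^T) 0 0 = lam.
  by rewrite -edot_flat edotC xE dotC.
have trA : - \tr (invmx (D *m D^T) *m
    \matrix_(i, j) (flat (hess F u i j) *m (flat (N p))^T) 0 0) = lam / 2.
  rewrite -HE /mean_curvature -/c gE; congr (- \tr (_ *m _)).
  by apply/matrixP => i j; rewrite [LHS]mxE [RHS]mxE hE edot_flat.
have psd (v : 'rV[R]_n) :
    0 <= \sum_(l < a) (\sum_i v 0 i * D i (lshift b l)) ^+ 2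
     + \sum_i \sum_j v 0 i * v 0 j * (flat (hess F u i j) *m (flat x)^T) 0 0.
  have [_] := Fmin v; rewrite -sq1 -p1; congr (_ <= _ + _).
    by apply: eq_bigr => l _; rewrite (ecoord_derive Uo Uu CF).
  under eq_bigr do rewrite (ecoord_derive2 Uo Uu CF) mulr_sumr.
  rewrite exchange_big; apply: eq_bigr => i _.
  under eq_bigr do rewrite mulr_sumr.
  rewrite exchange_big; apply: eq_bigr => j _.
  rewrite -edot_flat xE -p1 mulr_sumr; apply: eq_bigr => l _.
  by rewrite [LHS]mulrC mulrA.
have := min_trace_bound abn gU _ _ yy DN Dy yN' (mx1 _ _ _ (N1 p))
  Dx xN trA psd.
rewrite HE -sq1 /ecoord => H.
have {}H : lam ^+ 2 / 2 + \sum_(l < a) flat (N p) 0 (lshift b l) ^+ 2 <= a%:R.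
  by apply: H => l; rewrite ?row_mxEr ?row_mxEl mxE.
apply: le_trans H; rewrite lerD2r; lra.
Qed.

End Bound.

Theorem corollary9 (R : realType) (n k : nat)
  (hn : (3 <= n)%N) (hk : (2 <= k <= n - 1)%N)
  (M : smooth_manifold R n) (hM : [set: M] !=set0)
  (X N : M -> 'rV[R]_(n.+1 - k) * 'rV[R]_(k.+1))
  (hcyl : forall p, cylinder_soliton R n k (X p))
  (himm : immersion X)
  (hN : unit_normal X N)
  (hcomplete : riem_complete X)
  (hproper : proper_into (cylinder_soliton R n k) X)
  (hmin : f_minimal (@potential R (n.+1 - k) k.+1) X N) :
  (ereal_inf [set (mean_curvature X N p)%:E | p in [set: M]]
     < (Num.sqrt (2 * (n.+1 - k)%:R) / 2)%:E)%E.
Proof.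
have [k2 kn] := andP hk.
have Xc : continuous X by apply: smooth_map_continuous; case: himm.
have [p pmin] := proper_attains_min hM Xc hcyl hproper.
set a := (n.+1 - k)%N in X N hcyl himm hN hcomplete hproper hmin Xc p pmin *.
have a0 : (0 : R) < a%:R by rewrite ltr0n /a; lia.
have rho0 : (0 : R) < Num.sqrt (2 * (k - 1)%:R).
  by rewrite sqrtr_gt0 mulr_gt0 // ltr0n; lia.
have ak : (a + k.+1 = n.+2)%N by rewrite /a; lia.
have B := mean_curvature_bound_at_min ak rho0 hcyl himm hN hmin pmin.
rewrite ltNge; apply/negP => Hinf.
set s := Num.sqrt (2 * a%:R) in Hinf.
have s0 : 0 < s by rewrite sqrtr_gt0 mulr_gt0.
have ss : s ^+ 2 = 2 * a%:R by rewrite sqr_sqrtr // mulr_ge0 // ltW.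
have Hs : s / 2 <= mean_curvature X N p.
  rewrite -lee_fin; apply: le_trans Hinf _; apply: ereal_inf_lbound.
  by exists p.
(* B bounds 2 H^2 + |N1|^2 by a, while 2 H^2 >= s^2 / 2 = a. *)
have NN : dot (N p).1 (N p).1 <= 0 by nra.
have N0 i : (N p).1 0 i = 0.
  have sq0 j : 0 <= (N p).1 0 j * (N p).1 0 j by rewrite -expr2 sqr_ge0.
  apply/eqP; rewrite -sqrf_eq0 eq_le sqr_ge0 andbT; apply: le_trans NN.
  by rewrite /dot (bigD1 i) //= -expr2 lerDl sumr_ge0.
have := hmin p; rewrite /weighted_mean_curvature edot_grad_potential.
rewrite [dot _ _]big1 => [|i _]; last by rewrite N0 mulr0.
rewrite mul0r subr0; lra.
Qed.
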